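(* Let $\tau$ be a set partition of $[k]$ that contains a set partition $P$ of $[k']$, and let $r'$ be an integer with $k'>r'$ such that there are fewer than $r'$ indices $i$ with $1\le i\le k'-1$ for which $i$ and $i+1$ lie in different blocks of $P$. Then the number $A_n(\tau)$ of set partitions of $[n]$ avoiding $\tau$ satisfies $$A_n(\tau)\ge \Omega_k(1)^n\, n^{n\left(1-\frac{1}{k'-r'}\right)},$$ that is, there is a constant $c>0$ depending only on $k$ such that $A_n(\tau)\ge c^n n^{n\left(1-\frac{1}{k'-r'}\right)}$ for all $n\ge1$.
   Context: For a positive integer $n$, $[n]=\{1,2,\dots,n\}$. A set partition of $[n]$ is a set of pairwise disjoint nonempty subsets of $[n]$ (called blocks) whose union is $[n]$. A set partition $\sigma$ of $[n]$ contains a set partition $\tau$ of $[k]$ if there are elements $x_1<x_2<\cdots<x_k$ of $[n]$ such that for all $i,j\in[k]$, $x_i$ and $x_j$ lie in the same block of $\sigma$ if and only if $i$ and $j$ lie in the same block of $\tau$. Otherwise $\sigma$ avoids $\tau$. $A_n(\tau)$ denotes the number of set partitions of $[n]$ avoiding $\tau$. *)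

(* Defs.v *)
From HB Require Import structures.
From mathcomp Require Import all_boot all_order all_algebra.
From mathcomp Require Import reals exp.

Set Implicit Arguments.
Unset Strict Implicit.
Unset Printing Implicit Defensive.

(* The ground set [n] = {1, ..., n} is represented by 'I_n = {0, ..., n-1},
   via the order isomorphism i |-> i + 1. *)

Definition set_partition (n : nat) (s : {set {set 'I_n}}) : bool :=
  partition s [set: 'I_n].

Definition same_block (n : nat) (s : {set {set 'I_n}}) (x y : 'I_n) : bool :=
  [exists B in s, (x \in B) && (y \in B)].

(* The finite function x lists the elements x_1 < ... < x_k of [n]. *)
Definition contains (n k : nat) (s : {set {set 'I_n}}) (t : {set {set 'I_k}}) :
    bool :=
  [exists x : {ffun 'I_k -> 'I_n},
     [forall i : 'I_k, forall j : 'I_k, (i < j)%N ==> (x i < x j)%N] &&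
     [forall i : 'I_k, forall j : 'I_k,
        same_block s (x i) (x j) == same_block t i j]].

Definition num_avoiders (n k : nat) (t : {set {set 'I_k}}) : nat :=
  #|[set s : {set {set 'I_n}} | set_partition s & ~~ contains s t]|.

(* Only those i having a successor in 'I_k are counted, that is,
   1 <= i <= k - 1 in 1-based numbering. *)
Definition num_changes (k : nat) (s : {set {set 'I_k}}) : nat :=
  #|[set i : 'I_k |
      [exists j : 'I_k, (nat_of_ord j == i.+1) && ~~ same_block s i j]]|.

(* Main.v *)
(** Let [m = k' - r']. Split (most of) [[n]] into [m] consecutive intervals of
    length [N = n %/ m] and consider the partitions all of whose blocks are
    transversals of these intervals, the at most [m - 1] leftover elements being
    singletons. They correspond to the [(m - 1)]-tuples of permutations of an
    interval, so there are [N! ^ (m - 1) >= c ^ n * n ^ (n * (1 - 1 / m))] of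
    them. In a copy of [P] inside such a partition, the index of the interval
    must increase at each of the [>= m] adjacent pairs lying in the same block,
    which is impossible with [m] intervals. *)

Require Import Defs.
From HB Require Import structures.
From mathcomp Require Import all_boot all_order all_algebra all_fingroup.
From mathcomp Require Import reals exp.
From mathcomp Require Import zify.

Set Implicit Arguments.
Unset Strict Implicit.
Unset Printing Implicit Defensive.

Import Order.TTheory GRing.Theory Num.Theory.
Local Open Scope ring_scope.

Lemma containsP (n k : nat) (s : {set {set 'I_n}}) (t : {set {set 'I_k}}) :
  reflect (exists2 x : 'I_k -> 'I_n,
             forall i j : 'I_k, (i < j)%N -> (x i < x j)%N &
             forall i j : 'I_k, same_block s (x i) (x j) = same_block t i j)
          (contains s t).
Proof.
apply: (iffP existsP) => [[x /andP[/forallP lx /forallP sx]]|[x lx sx]].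
  exists x => i j.
    by move/implyP: (forallP (lx i) j).
  by move/eqP: (forallP (sx i) j).
exists (finfun x); apply/andP; split; apply/forallP => i; apply/forallP => j.
  by rewrite !ffunE; apply/implyP/lx.
by rewrite !ffunE sx.
Qed.

Lemma contains_trans (n k l : nat) (s : {set {set 'I_n}}) (t : {set {set 'I_k}})
    (u : {set {set 'I_l}}) : contains s t -> contains t u -> contains s u.
Proof.
move=> /containsP[x lx sx] /containsP[y ly sy].
by apply/containsP; exists (x \o y) => i j /=; [move/ly/lx | rewrite sx sy].
Qed.

(** Bounds [k'] by [k] when [tau] contains [P], so that the final constant can depend on [k]
    alone. *)
Lemma contains_leq (n k : nat) (s : {set {set 'I_n}}) (t : {set {set 'I_k}}) :
  contains s t -> (k <= n)%N.
Proof.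
move=> /containsP[x lx _]; rewrite -(card_ord k) -(card_ord n).
apply: (@leq_card _ _ x) => i j xij.
by apply: val_inj => /=; case: (ltngtP i j) => // /lx; rewrite xij ltnn.
Qed.

Lemma same_block_preim (n : nat) (T : eqType) (g : 'I_n -> T) (x y : 'I_n) :
  same_block (preim_partition g [set: 'I_n]) x y = (g x == g y).
Proof.
have eqg : {in [set: 'I_n] & &, equivalence_rel [rel a b | g a == g b]}.
  by move=> a b c _ _ _ /=; split=> // /eqP->.
have /and3P[_ tI _] := preim_partitionP g [set: 'I_n].
have cov a : a \in cover (preim_partition g [set: 'I_n]).
  by rewrite (cover_partition (preim_partitionP g [set: 'I_n])) inE.
have /= <- := pblock_equivalence_partition eqg (in_setT x) (in_setT y).
apply/existsP/idP => [[B /and3P[BP xB yB]]|yx].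
  by rewrite (def_pblock tI BP xB).
exists (pblock (preim_partition g [set: 'I_n]) x).
by rewrite pblock_mem ?mem_pblock // yx cov.
Qed.

Lemma contains_transversal_leq (n k m : nat) (s : {set {set 'I_n}})
    (t : {set {set 'I_k}}) (h : 'I_n -> nat) :
    (0 < k)%N ->
    (forall x, h x < m)%N ->
    {homo h : x y / (x <= y)%N >-> (x <= y)%N} ->
    (forall x y, same_block s x y -> h x = h y -> x = y) ->
  contains s t -> (k <= num_changes t + m)%N.
Proof.
move=> k0 hm hh hs /containsP[x lx sx].
set D := [set i : 'I_k | [exists j : 'I_k,
            (nat_of_ord j == i.+1) && ~~ same_block t i j]].
(* Going from [j] to [j.+1], either the two positions share a block and [h] strictly rises, or [j]
   is a new element of [D]; so the right-hand side grows by at least one. *)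
have key j (hj : (j < k)%N) :
    (j <= h (x (Ordinal hj)) + #|[set i in D | (i < j)%N]|)%N.
  elim: j hj => // j IH hj; have hj' : (j < k)%N := ltnW hj.
  set a := Ordinal hj'; set b := Ordinal hj.
  have lab : (x a < x b)%N by apply: lx => /=.
  have hab : (h (x a) <= h (x b))%N by apply/hh/ltnW.
  have IHj := IH hj'; rewrite -/a in IHj.
  have sub : [set i in D | (i < j)%N] \subset [set i in D | (i < j.+1)%N].
    by apply/subsetP => i; rewrite !inE => /andP[-> /leqW].
  have [sab|nab] := boolP (same_block t a b).
    have : h (x a) != h (x b).
      apply: contraTneq lab => /hs xab.
      by rewrite xab ?ltnn // sx.
    have := subset_leq_card sub; move: hab IHj; lia.
  suff : (#|[set i in D | (i < j)%N]| < #|[set i in D | (i < j.+1)%N]|)%N.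
    move: hab IHj; lia.
  apply/proper_card/properP; split=> //; exists a; rewrite !inE /= ?ltnn ?andbF //.
  by rewrite ltnSn andbT; apply/existsP; exists b; rewrite eqxx.
have hk : (k.-1 < k)%N by rewrite prednK.
have := key _ hk; have := hm (x (Ordinal hk)).
have : (#|[set i in D | (i < k.-1)%N]| <= num_changes t)%N.
  by apply/subset_leq_card/subsetP => i; rewrite inE => /andP[].
lia.
Qed.

(* Elements with the same label form a block. The elements below [N] are labelled
   by themselves, [a.+1 * N + b] by [s a b], and the elements from [M.+1 * N] on
   by themselves again, which makes them singletons. *)
Definition transversal_label (M N : nat) (s : {ffun 'I_M -> 'S_N}) (x : nat) :
    nat :=
  if (x < N)%N then x else
  if insub (x %/ N).-1 is Some a then
    if insub (x %% N)%N is Some b then s a b else x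
  else x.

Lemma transversal_label_small (M N : nat) (s : {ffun 'I_M -> 'S_N}) (x : nat) :
  (x < N)%N -> transversal_label s x = x.
Proof. by rewrite /transversal_label => ->. Qed.

Lemma transversal_label_mid (M N : nat) (s : {ffun 'I_M -> 'S_N})
    (a : 'I_M) (b : 'I_N) : transversal_label s (a.+1 * N + b) = s a b.
Proof.
have N0 : (0 < N)%N := leq_ltn_trans (leq0n b) (ltn_ord b).
rewrite /transversal_label ltnNge mulSn -addnA leq_addr /= addnA -mulSn.
by rewrite divnMDl // modnMDl modn_small // divn_small // addn0 /= !valK.
Qed.

Lemma transversal_label_large (M N : nat) (s : {ffun 'I_M -> 'S_N}) (x : nat) :
  (M.+1 * N <= x)%N -> transversal_label s x = x.
Proof.
rewrite /transversal_label => hx; case: ifP => // _.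
case: insubP => // a aM _; case: insubP => // b bN _.
have N0 : (0 < N)%N by case: (N) bN => // ; rewrite ?ltn0.
by move: aM; rewrite -leq_divRL // in hx; lia.
Qed.

(** The first index is the number of the interval containing [x]. Capping it at [M] puts the
    leftover elements into the last interval, which keeps [M.+1] values and monotonicity. For
    [N = 0] every [x] is leftover. *)
Variant transversal_spec (M N : nat) (s : {ffun 'I_M -> 'S_N}) (x : nat) :
    nat -> nat -> Prop :=
  | TransversalSmall of (x < N)%N : transversal_spec s x 0 x
  | TransversalMid (a : 'I_M) (b : 'I_N) of x = (a.+1 * N + b)%N :
      transversal_spec s x a.+1 (s a b)
  | TransversalLarge of (M.+1 * N <= x)%N :
      transversal_spec s x (minn (x %/ N) M) x.

Lemma transversalP (M N : nat) (s : {ffun 'I_M -> 'S_N}) (x : nat) :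
  transversal_spec s x (minn (x %/ N) M) (transversal_label s x).
Proof.
case: (ltnP x N) => [xN|Nx].
  rewrite transversal_label_small // divn_small // min0n; exact: TransversalSmall.
case: (leqP (M.+1 * N) x) => [lx|xl].
  by rewrite transversal_label_large //; apply: TransversalLarge.
have N0 : (0 < N)%N by case: (N) xl; rewrite ?muln0.
have q0 : (0 < x %/ N)%N by rewrite divn_gt0.
have qM : ((x %/ N).-1 < M)%N by move: xl; rewrite -ltn_divLR //; lia.
have [a [b [-> ex]]] : exists a : 'I_M, exists b : 'I_N,
    minn (x %/ N) M = a.+1 /\ x = (a.+1 * N + b)%N.
  exists (Ordinal qM), (Ordinal (ltn_pmod x N0)) => /=.
  by rewrite prednK // -divn_eq; split=> //; lia.
rewrite [in transversal_label _ _]ex transversal_label_mid.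
exact: TransversalMid ex.
Qed.

(** On an interval the labelling is the identity or a permutation. The only delicate case is a
    permuted element against a leftover one, both of index [M]: the former has a label below [N],
    the latter a label at least [M.+1 * N]. *)
Lemma transversal_label_inj (M N : nat) (s : {ffun 'I_M -> 'S_N}) (x y : nat) :
  transversal_label s x = transversal_label s y ->
  minn (x %/ N) M = minn (y %/ N) M -> x = y.
Proof.
case: (transversalP s x) => [xN|a b ->|lx];
  case: (transversalP s y) => [yN|c d ->|ly] //.
- move=> sb [ac]; have {}ac : a = c by apply: val_inj.
  by rewrite ac in sb *; rewrite (perm_inj (val_inj sb)).
- move=> sb; have := ltn_ord (s a b); rewrite sb => yN.
  by move: ly; rewrite leqNgt (leq_trans yN) // mulSn leq_addr.
- move=> sb; have := ltn_ord (s c d); rewrite -sb => yN.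
  by move: lx; rewrite leqNgt (leq_trans yN) // mulSn leq_addr.
Qed.

Definition transversal_partition (n M N : nat) (s : {ffun 'I_M -> 'S_N}) :
    {set {set 'I_n}} :=
  preim_partition (fun x : 'I_n => transversal_label s x) [set: 'I_n].

(** The partition determines [s]: the block of [a.+1 * N + b] meets the first interval exactly in
    [s a b]. *)
Lemma transversal_partition_inj (n M N : nat) : (M.+1 * N <= n)%N ->
  injective (@transversal_partition n M N).
Proof.
move=> hn s t est; apply/ffunP => a; apply/permP => b.
have ab : (a.+1 * N + b < n)%N.
  apply: leq_trans hn; apply: (@leq_trans (a.+2 * N)).
    by rewrite (mulSn a.+1) addnC ltn_add2r.
  by rewrite leq_mul2r !ltnS ltn_ord orbT.
have sn : (s a b < n)%N.
  by apply: leq_trans (ltn_ord _) (leq_trans _ hn); rewrite mulSn leq_addr.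
have : same_block (transversal_partition n s) (Ordinal ab) (Ordinal sn).
  rewrite same_block_preim /=.
  by rewrite transversal_label_mid transversal_label_small.
rewrite est same_block_preim /= transversal_label_mid transversal_label_small //.
by move=> /eqP tsab; apply/val_inj.
Qed.

Lemma num_avoiders_ge (n k k' M : nat) (tau : {set {set 'I_k}})
    (P : {set {set 'I_k'}}) :
    (0 < k')%N -> contains tau P -> (num_changes P + M.+1 < k')%N ->
  ((n %/ M.+1)`! ^ M <= num_avoiders n tau)%N.
Proof.
move=> k0 tauP hP; set N := (n %/ M.+1)%N.
have hn : (M.+1 * N <= n)%N by rewrite mulnC leq_divM.
have -> : (N`! ^ M = #|{ffun 'I_M -> 'S_N}|)%N.
  by rewrite card_ffun card_ord card_Sn.
rewrite -(card_imset _ (transversal_partition_inj hn)).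
apply/subset_leq_card/subsetP => _ /imsetP[s _ ->]; rewrite inE.
apply/andP; split; first exact: preim_partitionP.
apply/negP => /contains_trans /(_ tauP).
move=> /(contains_transversal_leq (m := M.+1)
  (h := fun x : 'I_n => minn (x %/ N) M) k0) => H.
suff : (k' <= num_changes P + M.+1)%N by lia.
apply: H => [x|x y xy|x y].
- by rewrite ltnS geq_minr.
- by have := leq_div2r N xy; lia.
- rewrite same_block_preim => /eqP exy hxy.
  exact/val_inj/(transversal_label_inj exy hxy).
Qed.

(* [n ^ j <= (n + j) ^_ j = 'C(n + j, j) * j`! <= 2 ^ (n + j) * j`!] *)
Lemma expn_leq_fact (n j : nat) : (n ^ j <= 2 ^ (n + j) * j`!)%N.
Proof.
have h1 i : (n ^ i * n`! <= (n + i)`!)%N.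
  elim: i => [|i IH]; first by rewrite mul1n addn0.
  rewrite expnS -mulnA addnS factS leq_mul //.
  by rewrite -addnS leq_addr.
(* The binomial coefficient is one term of the expansion of [(1 + 1) ^ (n + j)]. *)
have h2 : ('C(n + j, j) <= 2 ^ (n + j))%N.
  rewrite -[2%N]/(1 + 1)%N expnDn.
  have jn : (j < (n + j).+1)%N by rewrite ltnS leq_addl.
  by rewrite (bigD1 (Ordinal jn)) //= !exp1n !muln1 leq_addr.
have h3 := bin_fact (leq_addl n j); rewrite addnK in h3.
rewrite -(leq_pmul2r (fact_gt0 n)) (leq_trans (h1 j)) // -h3 -mulnA.
by rewrite leq_mul2r h2 orbT.
Qed.

(** The exponent [N.+1] makes up for the rounding in [N = n %/ M.+1]. The base 16 comes from
    [n + N.+1 + N <= 4 * n]. *)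
Lemma expn_leq_fact_floor (n N : nat) : (0 < n)%N -> (N <= n)%N ->
  (n ^ N.+1 <= 16 ^ n * N`!)%N.
Proof.
move=> n0 Nn; apply: (leq_trans (expn_leq_fact n N.+1)).
rewrite factS mulnA leq_mul2r; apply/orP; right.
have h1 : (N.+1 <= 2 ^ N)%N by apply: ltn_expl.
apply: (leq_trans (leq_mul (leqnn _) h1)).
rewrite -[16%N]/(2 ^ 4)%N -expnM -expnD leq_exp2l //; lia.
Qed.

Theorem mainTheorem2 (R : realType) (k : nat) (hk : (0 < k)%N) :
  exists2 c : R, 0 < c &
    forall (tau : {set {set 'I_k}}) (k' : nat) (P : {set {set 'I_k'}})
           (r' : int),
      set_partition tau ->
      (0 < k')%N -> set_partition P ->
      contains tau P ->
      r' < k'%:Z ->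
      (num_changes P)%:Z < r' ->
      forall n : nat, (1 <= n)%N ->
        c ^+ n * n%:R `^ (n%:R * (1 - 1 / (k'%:Z - r')%:~R))
          <= (num_avoiders n tau)%:R.
Proof.
(* Each of the [M] factorials costs a factor [16 ^ n], and [M <= k]. *)
exists (16%:R ^- k); first by rewrite invr_gt0 exprn_gt0.
move=> tau k' P r' _ k0 _ tauP rk dr n n0.
have kk := contains_leq tauP.
have [M eM] : exists M : nat, k'%:Z - r' = M.+1%:Z.
  by exists (`|(k'%:Z - r')|.-1)%N; lia.
have hP : (num_changes P + M.+1 < k')%N by lia.
have Mk : (M <= k)%N by lia.
have num := num_avoiders_ge n k0 tauP hP.
rewrite eM -pmulrn; set N := (n %/ M.+1)%N in num.
have Nn : (N <= n)%N by exact: leq_div.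
(* The left side is [M * n / M.+1], and [n < N.+1 * M.+1] by the definition of [N]. *)
have expo : n%:R * (1 - 1 / M.+1%:R) <= (N.+1 * M)%:R :> R.
  have -> : n%:R * (1 - 1 / M.+1%:R) = n%:R / M.+1%:R * M%:R :> R.
    rewrite -mulrA; congr (_ * _).
    rewrite -[X in X - _](@divff _ M.+1%:R) ?pnatr_eq0 // -mulrBl mulrC.
    by rewrite -(natrB R (isT : (1 <= M.+1)%N)) subSS subn0.
  rewrite natrM ler_wpM2r // ler_pdivrMr ?ltr0n // -natrM ler_nat.
  by apply: ltnW; rewrite ltn_ceil.
have pow : n%:R `^ (n%:R * (1 - 1 / M.+1%:R)) <= ((n ^ N.+1) ^ M)%:R :> R.
  rewrite -expnM natrX -powR_mulrn // ler_powR //.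
  by rewrite ler1n.
have fin : ((n ^ N.+1) ^ M <= (16 ^ k) ^ n * num_avoiders n tau)%N.
  apply: (@leq_trans ((16 ^ n * N`!) ^ M)).
    have := expn_leq_fact_floor n0 Nn.
    by case: (M) => // M' h; rewrite leq_exp2r.
  rewrite expnMn leq_mul // -!expnM leq_exp2l // mulnC.
  by rewrite leq_mul2r Mk orbT.
rewrite exprVn ler_pdivrMl ?exprn_gt0 //.
apply: (le_trans pow); rewrite -!natrX -natrM ler_nat.
exact: fin.
Qed.
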